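(* Let $\{e^{t\mathcal{L}}\}_{t\ge0}$ be a quantum dynamical semigroup of unital quantum channels on $M_d$. The following are equivalent: (i) $e^{t\mathcal{L}}$ is mixed Weyl-unitary for every $t\ge0$; (ii) $\mathcal{L}$ is a non-negative linear combination of maps of the form $\mathrm{Ad}_W-\mathrm{id}$ with $W$ a Weyl unitary; (iii) $\mathcal{L}$ is Weyl-covariant.
   Context: Index the standard basis of $\mathbb{C}^d$ by $\mathbb{Z}_d$, let $\xi=e^{2\pi i/d}$, $Ue_j=e_{j+1}$, $Ve_j=\xi^je_j$, and Weyl unitaries $W_{a,b}=U^aV^b$, $a,b\in\mathbb{Z}_d$. $\mathrm{Ad}_W(X)=W^*XW$. A linear map $\Phi$ on $M_d$ is mixed Weyl-unitary if $\Phi(X)=\sum_i\lambda_iU_iXU_i^*$ with $\lambda_i\ge0$, $\sum_i\lambda_i=1$ and each $U_i$ a Weyl unitary; it is Weyl-covariant if $\Phi(W_{a,b}XW_{a,b}^* )=W_{a,b}\Phi(X)W_{a,b}^*$ for all $X\in M_d$ and $a,b\in\mathbb{Z}_d$. A quantum dynamical semigroup of unital quantum channels is a family $\{\Phi_t=e^{t\mathcal{L}}\}_{t\ge0}$ of completely positive, unital, trace-preserving maps with $\Phi_0=\mathrm{id}$, $\Phi_s\Phi_t=\Phi_{s+t}$, continuous in $t$; $\mathcal{L}$ is its generator. *)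

(* Defs.v *)
From HB Require Import structures.
From mathcomp Require Import all_boot all_order all_algebra.
From mathcomp Require Import complex.
From mathcomp Require Import all_classical all_reals all_analysis.
Set Implicit Arguments.
Unset Strict Implicit.
Unset Printing Implicit Defensive.
Import Order.TTheory GRing.Theory Num.Theory.
Local Open Scope classical_set_scope.
Local Open Scope ring_scope.

(* R[i] carries its usual (modulus) metric topology, copied from the
   regular normed structure R[i]^o of the numClosedFieldType R[i]. *)
HB.instance Definition _ (R : realType) := PseudoPointedMetric.copy R[i] (R[i])^o.

Section Weyl.
Variables (R : realType) (n : nat).
(* The dimension is d = n.+1 (d >= 1); Z_d is represented by 'I_d. *)
Local Notation d := n.+1.
Local Notation C := R[i].
Local Notation M := 'M[C]_d.

Definition rc (x : R) : C := Complex x 0.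

Definition adjmx (A : M) : M := (map_mx Num.conj A)^T.

Definition xi : C := Complex (cos (2 * pi / d%:R)) (sin (2 * pi / d%:R)).

Definition Ushift : M := \matrix_(i, j) (i == ordS j)%:R.
Definition Vclock : M := \matrix_(i, j) ((i == j)%:R * xi ^+ j).
Definition Weyl (a b : 'I_d) : M := Ushift ^+ a *m Vclock ^+ b.

Definition AdW (W : M) (X : M) : M := adjmx W *m X *m W.

Definition psdF (I : finType) (A : I -> I -> C) : Prop :=
  forall v : I -> C, 0 <= \sum_(p : I) \sum_(q : I) (v p)^* * A p q * v q.

(* complete positivity: id_k (x) Phi is positive on M_k(M_d) for every k *)
Definition completely_positive (Phi : M -> M) : Prop :=
  forall (k : nat) (X : 'I_k -> 'I_k -> M),
    psdF (fun p q : 'I_k * 'I_d => X p.1 q.1 p.2 q.2) ->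
    psdF (fun p q : 'I_k * 'I_d => Phi (X p.1 q.1) p.2 q.2).

Definition trace_preserving (Phi : M -> M) : Prop :=
  forall X, \tr (Phi X) = \tr X.

Definition unital (Phi : M -> M) : Prop := Phi 1%:M = 1%:M.

Definition unital_channel (Phi : M -> M) : Prop :=
  completely_positive Phi /\ trace_preserving Phi /\ unital Phi.

Definition unital_QDS (Phi : R -> {linear M -> M}) (L : M -> M) : Prop :=
  [/\ forall X, Phi 0 X = X,
      forall s t, 0 <= s -> 0 <= t -> forall X, Phi (s + t) X = Phi s (Phi t X),
      forall t, 0 <= t -> unital_channel (Phi t),
      forall X, {within `[0, +oo[, continuous (fun t => Phi t X)} &
      forall X, (fun t : R => (rc t)^-1 *: (Phi t X - X)) @ 0^'+ --> (L X : M)].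

Definition mixed_Weyl_unitary (Phi : M -> M) : Prop :=
  exists (m : nat) (lam : 'I_m -> R) (a b : 'I_m -> 'I_d),
    [/\ forall i, 0 <= lam i, \sum_i lam i = 1 &
        forall X, Phi X = \sum_i rc (lam i) *: (Weyl (a i) (b i) *m X *m adjmx (Weyl (a i) (b i)))].

Definition Weyl_Lindblad (L : M -> M) : Prop :=
  exists (m : nat) (c : 'I_m -> R) (a b : 'I_m -> 'I_d),
    (forall i, 0 <= c i) /\
    forall X, L X = \sum_i rc (c i) *: (AdW (Weyl (a i) (b i)) X - X).

Definition Weyl_covariant (Phi : M -> M) : Prop :=
  forall (X : M) (a b : 'I_d),
    Phi (Weyl a b *m X *m adjmx (Weyl a b)) = Weyl a b *m Phi X *m adjmx (Weyl a b).

End Weyl.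

(* Main.v *)
(* Writing E_kl for the matrix units, any linear covariant map f satisfies
   f X = sum_(a, b) q_ab(f) W_ab X W_ab^*, where q_ab(f) is the value of the Choi
   matrix of f on the vector form of W_ab, divided by d^2: this is Fourier
   inversion on Z_d.  Complete positivity makes q_ab nonnegative and q_ab(id) = 0
   off (0, 0), so for (a, b) <> (0, 0) the coefficient
   q_ab(L) = lim q_ab(Phi_t - id) / t is nonnegative, and L 1 = 0 fixes q_00(L);
   this gives the Lindblad form as soon as L is covariant.  Conversely, if L is
   covariant, the commutator of Phi_t with conjugation by a Weyl unitary is o(t),
   and splitting [0, t] into N steps and telescoping shows that it vanishes; so
   Phi_t is covariant, and the expansion above makes it mixed Weyl-unitary. *)
Require Import Defs.
From HB Require Import structures.
From mathcomp Require Import all_boot all_order all_algebra.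
From mathcomp Require Import complex ring.
From mathcomp Require Import all_classical all_reals all_analysis.
Set Implicit Arguments.
Unset Strict Implicit.
Unset Printing Implicit Defensive.
Import Order.TTheory GRing.Theory Num.Theory.
Local Open Scope ring_scope.

(** * Roots of unity and the characters of Z_d *)

Section Characters.
Variables (R : realType) (n : nat).
Local Notation d := n.+1.
Local Notation C := R[i].
Local Notation M := 'M[C]_d.

Lemma xiX k :
  xi R n ^+ k = Complex (cos (2 * pi / d%:R * k%:R)) (sin (2 * pi / d%:R * k%:R)).
Proof.
elim: k => [|k IH]; first by rewrite expr0 mulr0 cos0 sin0.
rewrite exprS IH /xi; set h := 2 * pi / d%:R.
have -> : h * k.+1%:R = h * k%:R + h by rewrite -natr1 mulrDr mulr1.
rewrite cosD sinD; apply/eqP; rewrite eq_complex /=.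
by apply/andP; split; apply/eqP; ring.
Qed.

Lemma xi_expn : xi R n ^+ d = 1.
Proof.
rewrite xiX divfK ?pnatr_eq0 // mulr_natl cos2pi.
by rewrite sin_mulr2n sinpi mulr0 mul0rn.
Qed.

(** Half-angle argument: a real part equal to 1 would force [sin h = 0], but [h = pi / d * k] lies
    strictly between 0 and pi. *)
Lemma xi_expn_neq1 k : (0 < k < d)%N -> xi R n ^+ k != 1.
Proof.
move=> /andP[k0 kd]; rewrite xiX; apply/eqP => -[+ _].
set h : R := pi / d%:R * k%:R.
have -> : 2 * pi / d%:R * k%:R = h *+ 2 by rewrite /h -!mulrA mulr_natl.
have h0 : 0 < sin h.
  apply: sin_gt0_pi; rewrite /h mulr_gt0 ?divr_gt0 ?ltr0n ?pi_gt0 //=.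
  by rewrite mulrAC ltr_pdivrMr ?ltr0n // ltr_pM2l ?pi_gt0 // ltr_nat.
rewrite cos_mulr2n cos2sin2 => /eqP; rewrite -subr_eq0.
have -> : (1 - sin h ^+ 2) *+ 2 - 1 - 1 = - (sin h ^+ 2 *+ 2) by ring.
rewrite oppr_eq0 mulrn_eq0 /= expf_eq0 /= => /eqP h00.
by rewrite h00 ltxx in h0.
Qed.

(** The exponent is a product of natural numbers; since [xi] has d-th power 1, only residues matter
    and [chi] is a bicharacter of Z_d. *)
Definition chi (b j : 'I_d) : C := xi R n ^+ (b * j).

Lemma xi_modn k : xi R n ^+ (k %% d) = xi R n ^+ k.
Proof. by rewrite [in RHS](divn_eq k d) exprD mulnC exprM xi_expn expr1n mul1r. Qed.

Lemma chiC b j : chi b j = chi j b.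
Proof. by rewrite /chi mulnC. Qed.

Lemma chiDr b i j : chi b (i + j) = chi b i * chi b j.
Proof.
by rewrite /chi mulnC exprM xi_modn -exprM mulnC mulnDr exprD.
Qed.

Lemma chi0 b : chi b 0 = 1.
Proof. by rewrite /chi muln0. Qed.

(** Both sides are inverse to [chi b j], because a root of unity has modulus 1. *)
Lemma conj_chi b j : (chi b j)^* = chi b (- j).
Proof.
have xi1 : `|xi R n| = 1.
  apply/eqP; rewrite -(@pexpr_eq1 _ _ d) ?normr_ge0 //.
  by rewrite -normrX xi_expn normr1.
have H : chi b j * (chi b j)^* = 1.
  by rewrite -normCK /chi normrX xi1 !expr1n.
have nz : chi b j != 0.
  by apply/eqP => z; move: H; rewrite z mul0r => /eqP; rewrite eq_sym oner_eq0.
by apply: (mulfI nz); rewrite H -chiDr subrr chi0.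
Qed.

Lemma chiNl b j : chi (- b) j = chi b (- j).
Proof. by rewrite -conj_chi chiC -conj_chi chiC. Qed.

(** Orthogonality of characters: for [j != 0], multiplying the geometric sum by the nonzero
    [xi ^+ j - 1] gives [xi ^+ (j * d) - 1 = 0]. *)
Lemma sum_chi j : \sum_b chi b j = d%:R * (j == 0)%:R.
Proof.
have [->|j0] := eqVneq j 0.
  rewrite mulr1 (eq_bigr (fun=> 1)) => [|b _]; last exact: chi0.
  by rewrite sumr_const card_ord.
rewrite mulr0; have z1 : xi R n ^+ j - 1 != 0.
  rewrite subr_eq0 xi_expn_neq1 // ltn_ord andbT lt0n.
  by apply: contra_neq j0 => j0; apply/val_inj.
apply: (mulfI z1); rewrite mulr0.
rewrite (eq_bigr (fun b : 'I_d => (xi R n ^+ j) ^+ b)) => [|b _]; last first.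
  by rewrite /chi mulnC exprM.
by rewrite -subrX1 -exprM mulnC exprM xi_expn expr1n subrr.
Qed.

(** * Entries of Weyl unitaries and of their conjugations *)

Lemma UshiftX k i j : (Ushift R n ^+ k) i j = (i == j + inZp k)%:R.
Proof.
elim: k i j => [|k IH] i j.
  by rewrite expr0 !mxE; congr (_ == _)%:R; apply/val_inj; rewrite /= mod0n addn0 modn_small.
rewrite exprSr -mulmxE mxE (bigD1 (ordS j)) //= big1 ?addr0 => [|l lj]; last first.
  by rewrite [Ushift _ _ _ _]mxE (negPf lj) mulr0.
rewrite IH [Ushift _ _ _ _]mxE eqxx mulr1; congr (_ == _)%:R; apply/val_inj => /=.
by rewrite modnDm modnDmr addnS addSn.
Qed.

Lemma VclockX k i j : (Vclock R n ^+ k) i j = (i == j)%:R * xi R n ^+ (k * j).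
Proof.
elim: k i j => [|k IH] i j; first by rewrite expr0 !mxE mul0n mulr1.
rewrite exprSr -mulmxE mxE (bigD1 j) //= big1 ?addr0 => [|l lj]; last first.
  by rewrite [Vclock _ _ _ _]mxE (negPf lj) mul0r mulr0.
by rewrite IH [Vclock _ _ _ _]mxE eqxx mul1r -mulrA -exprD mulSn addnC.
Qed.

Lemma WeylE a b i j : Weyl R a b i j = (i == j + a)%:R * chi b j.
Proof.
rewrite mxE (bigD1 j) //= big1 ?addr0 => [|l lj]; last first.
  by rewrite VclockX (negPf lj) mul0r mulr0.
by rewrite UshiftX VclockX eqxx mul1r valZpK.
Qed.

Lemma adjmxE (A : M) i j : adjmx A i j = (A j i)^*.
Proof. by rewrite !mxE. Qed.

(** A Weyl unitary has one nonzero entry in each row and column, so both products collapse. Later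
    identities between conjugations are checked entrywise through this formula. *)
Lemma Weyl_conjE a b (X : M) p q :
  (Weyl R a b *m X *m adjmx (Weyl R a b)) p q
  = chi b (p - q) * X (p - a) (q - a).
Proof.
rewrite mxE (bigD1 (q - a)) //= big1 ?addr0 => [|l lj]; last first.
  rewrite adjmxE WeylE.
  by rewrite -subr_eq eq_sym (negPf lj) mul0r conjC0 mulr0.
rewrite adjmxE WeylE subrK eqxx mul1r conj_chi.
rewrite mxE (bigD1 (p - a)) //= big1 ?addr0 => [|l lj]; last first.
  by rewrite WeylE -subr_eq eq_sym (negPf lj) !mul0r.
rewrite WeylE subrK eqxx mul1r mulrAC -chiDr; congr (chi b _ * _).
by rewrite opprB addrA subrK.
Qed.

Lemma AdW_WeylE a b (X : M) p q :
  AdW (Weyl R a b) X p q = chi b (q - p) * X (p + a) (q + a).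
Proof.
rewrite /AdW mxE (bigD1 (q + a)) //= big1 ?addr0 => [|l lj]; last first.
  by rewrite WeylE (negPf lj) mul0r mulr0.
rewrite WeylE eqxx mul1r mxE (bigD1 (p + a)) //= big1 ?addr0 => [|l lj]; last first.
  by rewrite adjmxE WeylE (negPf lj) mul0r conjC0 mul0r.
by rewrite adjmxE WeylE eqxx mul1r conj_chi mulrC mulrA -chiDr.
Qed.

(** The adjoint of W_ab is W_(-a)(-b) up to a phase, and conjugation cancels the phase. *)
Lemma Weyl_conj_AdW a b (X : M) :
  Weyl R a b *m X *m adjmx (Weyl R a b) = AdW (Weyl R (- a) (- b)) X.
Proof.
by apply/matrixP => p q; rewrite Weyl_conjE AdW_WeylE chiNl opprB.
Qed.

(** * Fourier inversion for covariant maps; [weyl_coef] is the coefficient q_ab *)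

Definition weyl_coef (f : M -> M) (a b : 'I_d) : C :=
  d%:R ^- 2 * \sum_k \sum_l chi b (l - k) * f (delta_mx k l) (k + a) (l + a).

Lemma Weyl_conj_delta a b i j :
  Weyl R a b *m delta_mx i j *m adjmx (Weyl R a b)
  = chi b (i - j) *: delta_mx (i + a) (j + a).
Proof.
apply/matrixP => p q; rewrite Weyl_conjE !mxE !subr_eq.
by case: eqP => [->|_]; case: eqP => [->|_]; rewrite ?mulr0 //= opprD addrACA subrr addr0.
Qed.

(** Covariance under W_cb shifts all four indices by [c] and multiplies by a phase in [b]. Averaging
    over [b] kills the entry unless [i - j = p - q]; averaging over [c] gives the sum. *)
Lemma covariant_delta (f : {linear M -> M}) : Weyl_covariant f ->
  forall i j p q, f (delta_mx i j) p q
    = d%:R^-1 * (i - j == p - q)%:R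
      * \sum_c f (delta_mx (i + c) (j + c)) (p + c) (q + c).
Proof.
move=> cov i j p q.
have shift b c : f (delta_mx i j) p q
    = chi b (i - j - (p - q)) * f (delta_mx (i + c) (j + c)) (p + c) (q + c).
  have /matrixP/(_ (p + c) (q + c)) := cov (delta_mx i j) c b.
  rewrite Weyl_conj_delta linearZ /= mxE Weyl_conjE !addrK opprD addrACA subrr addr0.
  move=> E; rewrite chiDr mulrAC E mulrAC -chiDr subrr chi0 mul1r //.
have d0 : d%:R != 0 :> C by rewrite pnatr_eq0.
have H : d%:R * (d%:R * f (delta_mx i j) p q) =
   \sum_(b : 'I_d) \sum_(c : 'I_d) f (delta_mx i j) p q.
  by rewrite !sumr_const !card_ord !mulr_natl.
apply: (mulfI d0); apply: (mulfI d0); rewrite H.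
under eq_bigr => b _ do under eq_bigr => c _ do rewrite (shift b c).
under eq_bigr => b _ do rewrite -mulr_sumr.
by rewrite -mulr_suml sum_chi subr_eq0 -!mulrA mulVKf.
Qed.

Lemma covariant_decomp (f : {linear M -> M}) : Weyl_covariant f ->
  forall X, f X = \sum_(w : 'I_d * 'I_d) weyl_coef f w.1 w.2 *:
    (Weyl R w.1 w.2 *m X *m adjmx (Weyl R w.1 w.2)).
Proof.
move=> cov X.
suff H i j : f (delta_mx i j) = \sum_(w : 'I_d * 'I_d) weyl_coef f w.1 w.2 *:
    (Weyl R w.1 w.2 *m delta_mx i j *m adjmx (Weyl R w.1 w.2)).
  rewrite [X in f X]matrix_sum_delta linear_sum.
  under eq_bigr => i _ do rewrite linear_sum.
  under eq_bigr => i _ do under eq_bigr => j _ do rewrite linearZ /= H scaler_sumr.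
  under eq_bigr => i _ do rewrite exchange_big.
  rewrite exchange_big /=; apply: eq_bigr => w _.
  rewrite [X in _ *m X *m _]matrix_sum_delta mulmx_sumr mulmx_suml scaler_sumr.
  apply: eq_bigr => i _; rewrite mulmx_sumr mulmx_suml scaler_sumr.
  apply: eq_bigr => j _; rewrite -scalemxAr -scalemxAl !scalerA.
  by rewrite mulrC.
apply/matrixP => p q; rewrite covariant_delta // summxE.
under [RHS]eq_bigr => w _ do rewrite Weyl_conj_delta scalerA !mxE.
rewrite -(pair_bigA _ (fun a b => weyl_coef f a b * chi b (i - j) *
   ((p == i + a) && (q == j + a))%:R)) /=.
(* Only the shift [a = p - i] sends row [i] to row [p]. *)
rewrite [in RHS](bigD1 (p - i)) //= [X in _ = _ + X]big1 ?addr0 => [|a aN]; last first.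
  rewrite big1 // => b _; case: eqP => [pE|_]; last by rewrite mulr0.
  by rewrite pE addrC addKr eqxx in aN.
rewrite [in X in p == X]addrC subrK eqxx /= -mulr_suml.
have -> : (q == j + (p - i)) = (i - j == p - q).
  rewrite eq_sym addrCA -(opprB i) subr_eq addrC.
  by rewrite [RHS]eq_sym subr_eq.
case: eqP => [ijpq|_]; last by rewrite !mulr0 mul0r.
rewrite !mulr1.
have d0 : d%:R != 0 :> C by rewrite pnatr_eq0.
rewrite /weyl_coef.
under [RHS]eq_bigr => b _ do rewrite -mulrA mulr_suml.
rewrite -[RHS]mulr_sumr [in RHS]exchange_big /=.
rewrite expr2 invfM -mulrA; congr (_ * _).
under [in RHS]eq_bigr => k _ do under eq_bigr => b _ do rewrite mulr_suml.
under [in RHS]eq_bigr => k _ do rewrite exchange_big /=.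
(* The sum over [b] selects [l = k + (j - i)]; putting [k = i + c] then recovers the sum of
   [covariant_delta]. *)
have S k l : \sum_(b : 'I_d)
      chi b (l - k) * f (delta_mx k l) (k + (p - i)) (l + (p - i)) * chi b (i - j)
    = d%:R * (l == k + (j - i))%:R * f (delta_mx k l) (k + (p - i)) (l + (p - i)).
  under eq_bigr => b _ do rewrite mulrAC -chiDr.
  rewrite -mulr_suml sum_chi.
  by rewrite -[l == _]subr_eq0 opprD opprB -[l - k + _]addrA.
under [in RHS]eq_bigr => k _ do under eq_bigr => l _ do rewrite S -mulrA.
under [in RHS]eq_bigr => k _ do rewrite -mulr_sumr.
rewrite -mulr_sumr mulKf // [in RHS](reindex_inj (addrI i)) /=.
apply: eq_bigr => c _; rewrite (bigD1 (j + c)) //=.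
have -> : i + c + (j - i) = j + c by rewrite addrAC addrCA subrr addr0 addrC.
rewrite eqxx mul1r big1 ?addr0 => [|l lN]; last by rewrite (negPf lN) mul0r.
congr (f _ _ _).
  by rewrite addrAC addrCA subrr addr0 addrC.
rewrite [RHS]addrAC; congr (_ + c).
have -> : p = i - j + q by rewrite ijpq subrK.
by rewrite -(addrA i) [i + _]addrC addrK addNKr.
Qed.

(** Weyl unitaries commute up to a phase, which conjugation cancels; hence each conjugation is
    itself covariant. *)
Lemma Weyl_conjC a b a' b' (X : M) :
  Weyl R a b *m (Weyl R a' b' *m X *m adjmx (Weyl R a' b')) *m adjmx (Weyl R a b)
  = Weyl R a' b' *m (Weyl R a b *m X *m adjmx (Weyl R a b)) *m adjmx (Weyl R a' b').
Proof.
apply/matrixP => p q; rewrite !Weyl_conjE mulrCA; congr (_ * (_ * _)).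
- by rewrite opprB addrA subrK.
- by rewrite opprB addrA subrK.
by rewrite (addrAC p) (addrAC q).
Qed.

Lemma Weyl_conj_scalar a b : Weyl R a b *m (1%:M : M) *m adjmx (Weyl R a b) = 1%:M.
Proof.
apply/matrixP => p q; rewrite Weyl_conjE !mxE (inj_eq (addIr _)).
by case: eqP => [->|_]; rewrite ?mulr0 // subrr chi0 mulr1.
Qed.

Lemma Weyl_conj0 (X : M) : Weyl R 0 0 *m X *m adjmx (Weyl R 0 0) = X.
Proof. by apply/matrixP => p q; rewrite Weyl_conjE !subr0 chiC chi0 mul1r. Qed.

(** If [a != 0], every matrix unit entry in the sum is zero; if [a = 0], the sum over [l] is that of
    a nontrivial character. *)
Lemma weyl_coef_id (a b : 'I_d) : (a, b) != (0, 0) -> weyl_coef id a b = 0.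
Proof.
move=> ab0; rewrite /weyl_coef.
under eq_bigr => k _ do under eq_bigr => l _ do rewrite mxE.
have [a0|a0] := eqVneq a 0; last first.
  rewrite big1 ?mulr0 // => k _; rewrite big1 // => l _.
  have -> : (k + a == k) = false by rewrite -subr_eq0 addrAC subrr add0r; exact: (negPf a0).
  by rewrite mulr0.
have b0 : b != 0 by apply: contraNneq ab0 => ->; rewrite a0.
have sum0 : \sum_l chi b l = 0.
  by rewrite (eq_bigr (chi^~ b)) ?sum_chi ?(negPf b0) ?mulr0 // => l _; exact: chiC.
rewrite big1 ?mulr0 // => k _; rewrite a0 addr0 eqxx.
transitivity ((\sum_l chi b l) * chi b (- k)); last by rewrite sum0 mul0r.
by rewrite mulr_suml; apply: eq_bigr => l _; rewrite addr0 eqxx mulr1 chiDr.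
Qed.

(** * Positivity of the Choi matrix and the bounds it yields *)

Lemma choi_psd (f : M -> M) : completely_positive f ->
  psdF (fun p q : 'I_d * 'I_d => f (delta_mx p.1 q.1) p.2 q.2).
Proof.
move=> /(_ d (fun i j => delta_mx i j)); apply => v.
(* The block matrix of matrix units has rank one: its form at [v] is the squared modulus of the sum
   of the diagonal values [v (i, i)]. *)
pose S := \sum_(p : 'I_d * 'I_d) (p.2 == p.1)%:R * v p.
suff -> : \sum_p \sum_q (v p)^* * delta_mx p.1 q.1 p.2 q.2 * v q = S^* * S.
  by rewrite mulrC mul_conjC_ge0.
rewrite rmorph_sum mulr_suml; apply: eq_bigr => p _.
rewrite mulr_sumr; apply: eq_bigr => q _.
by rewrite mxE mulrA rmorphM rmorph_nat -mulnb natrM !mulrA [_^* * _]mulrC.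
Qed.

Lemma weyl_coef_ge0 (f : M -> M) a b :
  completely_positive f -> 0 <= weyl_coef f a b.
Proof.
(* The test vector lists the entries of W_ab, column index first. *)
move=> /choi_psd /(_ (fun p => (p.2 == p.1 + a)%:R * chi b p.1)).
rewrite /weyl_coef => H; apply: mulr_ge0; first by rewrite invr_ge0 exprn_ge0.
apply: le_trans H _; rewrite le_eqVlt; apply/orP; left; apply/eqP.
rewrite -(pair_bigA _ (fun k p => \sum_q ((p == k + a)%:R * chi b k)^*
  * f (delta_mx k q.1) p q.2 * ((q.2 == q.1 + a)%:R * chi b q.1))) /=.
apply: eq_bigr => k _; rewrite (bigD1 (k + a)) //= [X in _ + X]big1 ?addr0; last first.
  move=> p pN; rewrite big1 // => q _.
  by rewrite (negPf pN) mul0r conjC0 !mul0r.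
rewrite -(pair_bigA _ (fun l q => ((k + a == k + a)%:R * chi b k)^*
  * f (delta_mx k l) (k + a) q * ((q == l + a)%:R * chi b l))) /=.
apply: eq_bigr => l _; rewrite (bigD1 (l + a)) //= [X in _ + X]big1 ?addr0; last first.
  by move=> p pN; rewrite (negPf pN) mul0r mulr0.
by rewrite !eqxx !mul1r conj_chi mulrAC -chiDr addrC.
Qed.

(* Polarization: A p q is a combination of four values of the form. *)
Lemma psdF_bound (I : finType) (A : I -> I -> C) p q :
  psdF A -> 0 <= A p p /\ `|A p q| <= A p p + A q q.
Proof.
move=> psdA.
have F u : 0 <= A p p + u * A p q + u^* * (A q p + u * A q q).
  have := psdA (fun r => (r == p)%:R + u * (r == q)%:R).
  have sumE (G : I -> C) z : \sum_r ((r == p)%:R + z * (r == q)%:R) * G r = G p + z * G q.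
    under eq_bigr => r _ do rewrite mulrDl -mulrA.
    rewrite big_split /= -mulr_sumr.
    rewrite (bigD1 p) //= eqxx mul1r big1 ?addr0 => [|r /negPf->]; last by rewrite mul0r.
    congr (_ + _ * _).
    by rewrite (bigD1 q) //= eqxx mul1r big1 ?addr0 => [|r /negPf->]; last by rewrite mul0r.
  under eq_bigr => r _.
    under eq_bigr => s _ do rewrite mulrC [_^* * _]mulrC mulrA.
    rewrite -mulr_suml sumE mulrC rmorphD rmorphM !rmorph_nat; over.
  by rewrite sumE.
have i2 : 'i * 'i = -1 :> C by rewrite -expr2 sqrCi.
have App : 0 <= A p p by have := F 0; rewrite conjC0 !mul0r !addr0.
split=> //.
have -> : A p q = 4^-1 *
   ((A p p + 1 * A p q + 1^* * (A q p + 1 * A q q))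
  - (A p p + (-1) * A p q + (-1)^* * (A q p + (-1) * A q q))
  - 'i * (A p p + 'i * A p q + 'i^* * (A q p + 'i * A q q))
  + 'i * (A p p + (- 'i) * A p q + (- 'i)^* * (A q p + (- 'i) * A q q))).
  rewrite !rmorphN !rmorph1 /= conjCi.
  apply: (@mulfI _ 4); first by rewrite pnatr_eq0.
  rewrite mulrA divff ?pnatr_eq0 // mul1r.
  set j : C := 'i in i2 *.
  have -> : j * (A p p + j * A p q + - j * (A q p + j * A q q))
     = j * A p p + (j * j) * (A p q - A q p - j * A q q) by ring.
  have -> : j * (A p p + - j * A p q + - - j * (A q p + - j * A q q))
     = j * A p p - (j * j) * (A p q - A q p + j * A q q) by ring.
  rewrite i2; ring.
rewrite normrM normfV normr_nat.
rewrite ler_pdivrMl ?ltr0n //.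
apply: le_trans (ler_normD _ _) _.
apply: le_trans (lerD (ler_normB _ _) (lexx _)) _.
apply: le_trans (lerD (lerD (ler_normB _ _) (lexx _)) (lexx _)) _.
(* The four values are non-negative, so they equal their norms; the cross terms cancel in their sum,
   leaving [4 * (A p p + A q q)]. *)
rewrite !(normrM 'i) normCi !(mul1r `|_|) !(ger0_norm (F _)).
rewrite !rmorphN !rmorph1 /= conjCi le_eqVlt; apply/orP; left; apply/eqP.
set j : C := 'i in i2 *.
transitivity (4 * A p p + (2 - 2 * (j * j)) * A q q); first by ring.
by rewrite i2; ring.
Qed.

(** The diagonal entries of the image of [delta_mx k k] are non-negative with sum 1; the 2 adds two
    such entries. The bound does not depend on the channel. *)
Lemma channel_delta_bound (f : M -> M) i j p q :
  completely_positive f -> trace_preserving f -> `|f (delta_mx i j) p q| <= 2.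
Proof.
move=> /choi_psd psd tp.
have diag k r : f (delta_mx k k) r r <= 1.
  have -> : 1 = \tr (f (delta_mx k k)).
    rewrite tp /mxtrace (bigD1 k) //= big1 ?addr0 => [|l lk]; rewrite mxE ?eqxx //.
    by rewrite (negPf lk).
  rewrite /mxtrace (bigD1 r) //= lerDl sumr_ge0 // => s _.
  by have [] := psdF_bound (k, s) (k, s) psd.
have [_ /= /le_trans] := psdF_bound (i, p) (j, q) psd; apply.
by rewrite -[2]/(1 + 1) lerD.
Qed.

End Characters.

(** * From non-negative coefficients to the mixed and Lindblad forms *)

Section Maps.
Variables (R : realType) (n : nat).
Local Notation d := n.+1.
Local Notation C := R[i].
Local Notation M := 'M[C]_d.
Local Notation conjW a b X := (Weyl R a b *m X *m adjmx (Weyl R a b)).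

(** The definitions of both forms sum over an ordinal, the Fourier expansion over pairs; [enum_val]
    translates. *)
Lemma big_Weyl_index (V : nmodType) (F : 'I_d * 'I_d -> V) :
  \sum_(i < #|{: 'I_d * 'I_d}|) F (enum_val i) = \sum_w F w.
Proof. by rewrite -(big_enum_val F). Qed.

Lemma rc_Re (z : C) : 0 <= z -> rc (complex.Re z) = z.
Proof. by move=> /ger0_real/RRe_real. Qed.

Lemma Re_ge0 (z : C) : 0 <= z -> 0 <= complex.Re z.
Proof. by rewrite lecE => /andP[]. Qed.

Lemma Weyl_conj_lin a b (X Y : M) (k : C) :
  conjW a b (k *: X + Y) = k *: conjW a b X + conjW a b Y.
Proof. by rewrite mulmxDr mulmxDl -scalemxAr -scalemxAl. Qed.

Lemma Weyl_conj_sum (I : finType) a b (F : I -> M) :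
  conjW a b (\sum_i F i) = \sum_i conjW a b (F i).
Proof. by rewrite mulmx_sumr mulmx_suml. Qed.

Lemma covariant_mixed (f : {linear M -> M}) :
  completely_positive f -> unital f -> Weyl_covariant f -> mixed_Weyl_unitary f.
Proof.
move=> cp un cov; have ge0 a b := weyl_coef_ge0 a b cp.
pose c (w : 'I_d * 'I_d) := weyl_coef f w.1 w.2.
exists #|{: 'I_d * 'I_d}|, (fun i => complex.Re (c (enum_val i))),
  (fun i => (enum_val i).1), (fun i => (enum_val i).2); split=> [i||X].
- exact/Re_ge0/ge0.
- rewrite (big_Weyl_index (fun w => complex.Re (c w))).
  apply: (@complexI R); rewrite rmorph_sum rmorph1 /=.
  (* Every Weyl conjugation fixes the identity, so the expansion of [f 1%:M] computes the total
     weight. *)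
  have /matrixP/(_ 0 0) := covariant_decomp cov 1%:M.
  rewrite un summxE mxE eqxx mulr1n => ->; apply: eq_bigr => w _.
  by rewrite mxE Weyl_conj_scalar !mxE eqxx mulr1; exact: rc_Re (ge0 _ _).
rewrite (big_Weyl_index (fun w => rc (complex.Re (c w)) *: conjW w.1 w.2 X)).
by rewrite covariant_decomp //; apply: eq_bigr => w _; rewrite /c (rc_Re (ge0 _ _)).
Qed.

Lemma mixed_covariant (f : M -> M) : mixed_Weyl_unitary f -> Weyl_covariant f.
Proof.
move=> [m [lam [a [b [_ _ fE]]]]] X a' b'; rewrite !fE Weyl_conj_sum.
by apply: eq_bigr => i _; rewrite -scalemxAr -scalemxAl Weyl_conjC.
Qed.

Lemma Lindblad_covariant (L : M -> M) : Weyl_Lindblad L -> Weyl_covariant L.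
Proof.
move=> [m [c [a [b [_ LE]]]]] X a' b'; rewrite !LE Weyl_conj_sum.
apply: eq_bigr => i _; rewrite -scalemxAr -scalemxAl mulmxBr mulmxBl.
by rewrite -{1 2}[a i]opprK -{1 2}[b i]opprK -!Weyl_conj_AdW Weyl_conjC.
Qed.

Lemma covariant_Lindblad (L : {linear M -> M}) :
  L 1%:M = 0 -> (forall a b : 'I_d, (a, b) != (0, 0) -> 0 <= weyl_coef L a b) ->
  Weyl_covariant L -> Weyl_Lindblad L.
Proof.
move=> L1 ge0 cov.
(* No sign is known for the coefficient at (0, 0); its term [AdW W - id] vanishes, so the weight
   there is set to 0. *)
pose c (w : 'I_d * 'I_d) := if w == (0, 0) then 0 else complex.Re (weyl_coef L w.1 w.2).
exists #|{: 'I_d * 'I_d}|, (fun i => c (enum_val i)),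
  (fun i => - (enum_val i).1), (fun i => - (enum_val i).2); split=> [i|X].
  rewrite /c; case: ifPn => // w0; apply: Re_ge0.
  by move: w0; case: (enum_val i) => a b w0; exact: ge0.
rewrite (big_Weyl_index (fun w => rc (c w) *: (AdW (Weyl R (- w.1) (- w.2)) X - X))).
have sum0 : \sum_(w : 'I_d * 'I_d) weyl_coef L w.1 w.2 = 0.
  have /matrixP/(_ 0 0) := covariant_decomp cov 1%:M.
  rewrite L1 summxE mxE => E0; rewrite [RHS]E0; apply: eq_bigr => w _.
  by rewrite mxE Weyl_conj_scalar !mxE eqxx mulr1.
(* As the coefficients sum to 0, one copy of [X] can be subtracted in every term. *)
transitivity (L X - (\sum_(w : 'I_d * 'I_d) weyl_coef L w.1 w.2) *: X).
  by rewrite sum0 scale0r subr0.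
rewrite covariant_decomp // scaler_suml -sumrB.
apply: eq_bigr => -[a b] _ /=; rewrite -scalerBr Weyl_conj_AdW /c.
case: eqVneq => [[-> ->]|w0]; last by rewrite (rc_Re (ge0 _ _ w0)).
by rewrite -Weyl_conj_AdW Weyl_conj0 subrr !scaler0.
Qed.

Lemma linear_delta (f : M -> M) : linear f ->
  forall X, f X = \sum_i \sum_j X i j *: f (delta_mx i j).
Proof.
move=> lf X; pose g := HB.pack_for {linear M -> M} f (GRing.isLinear.Build _ _ _ _ f lf).
have -> : f = g by [].
rewrite [X in g X]matrix_sum_delta linear_sum; apply: eq_bigr => i _.
by rewrite linear_sum; apply: eq_bigr => j _; rewrite linearZ.
Qed.

(** The factor [d * d] counts the matrix units. Linearity is a predicate because the lemma is also
    applied to the commutator, a plain function. *)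
Lemma linear_bound (f : M -> M) (B e : C) (X : M) : linear f ->
  (forall i j p q, `|f (delta_mx i j) p q| <= B) ->
  (forall p q, `|X p q| <= e) ->
  forall p q, `|f X p q| <= (d * d)%:R * (e * B).
Proof.
move=> lf fB Xe p q; rewrite linear_delta // summxE.
apply: le_trans (ler_norm_sum _ _ _) _.
have -> : (d * d)%:R * (e * B) = \sum_(i < d) \sum_(j < d) e * B.
  by rewrite !sumr_const !card_ord -mulrnA mulr_natl.
apply: ler_sum => i _; rewrite summxE; apply: le_trans (ler_norm_sum _ _ _) _.
by apply: ler_sum => j _; rewrite mxE normrM ler_pM.
Qed.

End Maps.

(** * Right limits at 0 of complex functions *)

Section Limits.
Variable R : realType.
Local Notation C := R[i].
Local Notation Co := (R[i]^o).
Implicit Types f g : R -> C.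

Definition rlim f (l : C) : Prop := ((f : R -> Co) @ 0^'+ --> (l : Co))%classic.
Local Notation "f ~> l" := (rlim f l) (at level 70).

Lemma rlim_eq f g (l l' : C) : (forall t, 0 < t -> f t = g t) ->
  f ~> l -> g ~> l' -> l = l'.
Proof.
move=> fg fl gl.
have gl' : g ~> l.
  apply: cvg_trans fl; apply: near_eq_cvg; near=> t; rewrite fg //.
apply: (@cvg_unique Co _ _ _ _ _ gl' gl); exact: norm_hausdorff.
Unshelve. all: by end_near. Qed.

(** As [f] agrees with its norm for positive times, its limit equals its own norm. *)
Lemma rlim_ge0 f (l : C) : (forall t, 0 < t -> 0 <= f t) -> f ~> l -> 0 <= l.
Proof.
move=> f0 fl; have nl : (fun t => `|f t|) ~> `|l| by exact: (cvg_norm fl).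
by rewrite (rlim_eq _ fl nl) => [|t /f0/ger0_norm->].
Qed.

Lemma rlimZ f (l k : C) : f ~> l -> (fun t => k * f t) ~> k * l.
Proof. by move=> fl; apply: (@cvgM C R _ _ (fun=> k)) fl; exact: cvg_cst. Qed.

Arguments rlimZ {f l} k _.

Lemma rlim_sum (I : finType) (f : I -> R -> C) (l : I -> C) :
  (forall i, f i ~> l i) -> (fun t => \sum_i f i t) ~> \sum_i l i.
Proof.
move=> fl; have := @cvg_big Co I +%R 0 xpredT (@add_continuous Co) R (0^'+)%classic.
by move=> /(_ (index_enum I) f l _ (fun i _ => fl i)); apply.
Qed.

Lemma rlimD f g (l l' : C) : f ~> l -> g ~> l' -> (fun t => f t + g t) ~> l + l'.
Proof. by move=> fl gl; exact: cvgD fl gl. Qed.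

Lemma rlim0_norm f (l e : C) : f ~> l -> 0 < e -> exists2 h0 : R, 0 < h0 &
  forall h, 0 < h -> h < h0 -> `|l - f h| < e.
Proof.
move=> /cvgrPdist_lt fl e0; have [h0 /= h00 H] := fl e e0; exists h0 => // h h1 h2.
by apply: H => //=; rewrite sub0r normrN gtr0_norm.
Qed.

(** * Properties of the generator inherited from the difference quotients *)

Variable n : nat.
Local Notation d := n.+1.
Local Notation M := 'M[C]_d.
Local Notation conjW a b X := (Weyl R a b *m X *m adjmx (Weyl R a b)).
Variables (Phi : R -> {linear M -> M}) (L : M -> M).
Hypothesis QDS : unital_QDS Phi L.

(** A neighbourhood of one entry extends to a matrix neighbourhood that leaves the other entries
    free. *)
Lemma generator_entry X i j :
  (fun t => (rc t)^-1 * (Phi t X i j - X i j)) ~> L X i j.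
Proof.
have [_ _ _ _ /(_ X) HL] := QDS.
move=> A nA; have nB : nbhs (L X) [set Y : M | A (Y i j)]%classic.
  exists (fun k l => if (k == i) && (l == j) then A else setT) => [k l|Y /= AY].
    case: (_ && _) / andP => [[/eqP-> /eqP->]|_].
    exact: nA.
  exact: filterT.
  by have := AY i j; rewrite !eqxx.
have := HL _ nB; rewrite /nbhs /=; apply: filterS => t /=.
by rewrite !mxE.
Qed.

Arguments generator_entry : clear implicits.

Lemma generator_linear : linear L.
Proof.
move=> k X Y; apply/matrixP => i j; rewrite !mxE.
apply: rlim_eq (generator_entry _ i j)
  (rlimD (rlimZ k (generator_entry X i j)) (generator_entry Y i j)) => t t0.
by rewrite linearP !mxE; ring.
Qed.

Lemma generator_unital : L 1%:M = 0.
Proof.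
have [_ _ ch _ _] := QDS.
apply/matrixP => i j; rewrite [RHS]mxE.
have c0 : (fun=> 0) ~> 0 by exact: cvg_cst.
apply: rlim_eq (generator_entry _ i j) c0 => t t0.
by have [_ [_ ->]] := ch t (ltW t0); rewrite subrr mulr0.
Qed.

Lemma generator_covariant :
  (forall t, 0 < t -> Weyl_covariant (Phi t)) -> Weyl_covariant L.
Proof.
move=> cov X a b; apply/matrixP => i j; rewrite Weyl_conjE.
apply: rlim_eq (generator_entry _ i j) (rlimZ _ (generator_entry X _ _)) => t t0.
by rewrite cov // !Weyl_conjE; ring.
Qed.

Lemma generator_coef_ge0 (a b : 'I_d) : (a, b) != (0, 0) -> 0 <= weyl_coef L a b.
Proof.
have [_ _ ch _ _] := QDS.
move=> ab0; apply: rlim_ge0 (rlimZ _ (rlim_sum _)) => [t t0|k]; last first.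
  by apply: rlim_sum => l; apply: rlimZ; exact: generator_entry.
have [cp _] := ch t (ltW t0).
have -> : d%:R ^- 2 * (\sum_k \sum_l chi R b (l - k) *
     ((rc t)^-1 * (Phi t (delta_mx k l) (k + a) (l + a) - delta_mx k l (k + a) (l + a))))
   = (rc t)^-1 * (weyl_coef (Phi t) a b - weyl_coef id a b).
  rewrite /weyl_coef -[in RHS]mulrBr [RHS]mulrCA -sumrB [in RHS]mulr_sumr; congr (_ * _).
  apply: eq_bigr => k _.
  rewrite -sumrB [in RHS]mulr_sumr; apply: eq_bigr => l _.
  by rewrite -[in RHS]mulrBr mulrCA.
rewrite weyl_coef_id // subr0 mulr_ge0 ?weyl_coef_ge0 // invr_ge0.
by rewrite ler0c ltW.
Qed.

(** * Vanishing of the commutator with a Weyl conjugation *)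

Section Commutator.
Variables a b : 'I_d.
Let comm t (X : M) := Phi t (conjW a b X) - conjW a b (Phi t X).

Lemma comm_linear t : linear (comm t).
Proof.
move=> k X Y; rewrite /comm Weyl_conj_lin !(linearP (Phi t)) Weyl_conj_lin.
by rewrite scalerBr opprD addrACA.
Qed.

(** The derivative of the commutator at 0 is that of [L], hence 0. Finitely many entries are
    involved, so the least of their thresholds serves for all. *)
Lemma comm_small (e : C) : Weyl_covariant L -> 0 < e ->
  exists2 h0 : R, 0 < h0 & forall h, 0 < h -> h < h0 ->
  forall i j p q, `|comm h (delta_mx i j) p q| <= rc h * e.
Proof.
move=> cov e0.
have H (x : 'I_d * 'I_d * 'I_d * 'I_d) : exists2 h0 : R, 0 < h0 &
    forall h, 0 < h -> h < h0 ->
    `|comm h (delta_mx x.1.1.1 x.1.1.2) x.1.2 x.2| <= rc h * e.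
  case: x => [[[i j] p] q] /=; set X := delta_mx i j.
  have lim0 := rlimD (generator_entry (conjW a b X) p q)
    (rlimZ (- chi R b (p - q)) (generator_entry X (p - a) (q - a))).
  have [h0 h00 small] := rlim0_norm lim0 e0; exists h0 => // h hp hh.
  have rch : 0 < rc h by rewrite ltcR.
  have L0 : L (conjW a b X) p q + - chi R b (p - q) * L X (p - a) (q - a) = 0.
    by rewrite cov Weyl_conjE mulNr subrr.
  have := small h hp hh; rewrite L0 sub0r normrN => /ltW le_e.
  rewrite mulrC -ler_pdivrMr //; apply: le_trans le_e.
  rewrite -[X in _ / X](gtr0_norm rch) -normfV -normrM le_eqVlt; apply/orP; left.
  apply/eqP; congr `|_|.
  by rewrite /comm mxE [(- _ : M) _ _]mxE !Weyl_conjE; ring.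
have [h hP] := choice (fun x => let: ex_intro2 h p q := H x in ex_intro _ h (conj p q)).
exists (\big[Num.min/1]_x h x).
  by apply/bigmin_gtP; split=> // x _; have [] := hP x.
move=> t t0 /bigmin_gtP[_ th] i j p q.
by have [_ /(_ t t0 (th (i, j, p, q) isT))] := hP (i, j, p, q).
Qed.

Lemma QDS_bound t (X : M) (e : C) : 0 <= t -> (forall p q, `|X p q| <= e) ->
  forall p q, `|Phi t X p q| <= (d * d)%:R * (e * 2).
Proof.
have [_ _ ch _ _] := QDS; move=> t0 Xe; have [cp [tp _]] := ch t t0.
apply: linear_bound Xe => [|i j p q]; first exact: linearP.
exact: channel_delta_bound.
Qed.

(* comm ((k+1)h) = Phi h (comm (kh)) + comm h (Phi (kh)); the extra factor
   Phi (mh) in the induction keeps the channel bound from being iterated. *)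
Lemma comm_telescope (e c : C) (h : R) (X : M) : 0 < h ->
  (forall i j p q, `|comm h (delta_mx i j) p q| <= rc h * c) ->
  (forall p q, `|X p q| <= e) ->
  forall k m p q, `|Phi (m%:R * h) (comm (k%:R * h) X) p q|
    <= k%:R * ((d * d)%:R * ((d * d)%:R * ((d * d)%:R * (e * 2) * (rc h * c)) * 2)).
Proof.
have [P0 PD _ _ _] := QDS.
move=> h0 small Xe; have kh0 k : 0 <= k%:R * h by rewrite mulr_ge0 // ltW.
elim=> [|k IH] m p q.
  by rewrite mul0r /comm !P0 subrr linear0 mxE normr0 mul0r.
have step : comm (k.+1%:R * h) X
    = Phi h (comm (k%:R * h) X) + comm h (Phi (k%:R * h) X).
  have -> : k.+1%:R * h = h + k%:R * h by rewrite -natr1 mulrDl mul1r addrC.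
  by rewrite /comm !PD ?kh0 ?(ltW h0) // (linearB (Phi h)) addrA subrK.
rewrite step (linearD (Phi _)) -PD ?(ltW h0) // mxE.
have -> : m%:R * h + h = m.+1%:R * h by rewrite -natr1 mulrDl mul1r.
apply: le_trans (ler_normD _ _) _.
rewrite -[k.+1%:R]natr1 mulrDl mul1r; apply: lerD; first exact: IH.
apply: QDS_bound => // p' q'; apply: linear_bound => //; first exact: comm_linear.
exact: QDS_bound.
Qed.

Lemma comm0 t X : Weyl_covariant L -> 0 <= t -> comm t X = 0.
Proof.
move=> cov t0; apply/matrixP => p q; rewrite [RHS]mxE.
have [P0 _ _ _ _] := QDS.
pose e : C := \sum_i \sum_j `|X i j|.
have Xe i j : `|X i j| <= e.
  rewrite /e (bigD1 i) //= (bigD1 j) //= -addrA lerDl addr_ge0 ?sumr_ge0 // => k _.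
  exact: sumr_ge0.
have e0 : 0 <= e by apply: le_trans (Xe 0 0).
move: t0; rewrite le_eqVlt => /predU1P[<-|t0].
  by rewrite /comm !P0 subrr mxE.
pose K : C := (d * d)%:R * ((d * d)%:R * ((d * d)%:R * (e * 2)) * 2) * rc t.
have K0 : 0 <= K by rewrite !mulr_ge0 // ler0c ltW.
have bound (c : C) : 0 < c -> `|comm t X p q| <= K * c.
  move=> c0; have [h0 h00 small] := comm_small cov c0.
  (* Enough steps to make each one, of length [t / N], shorter than [h0]. *)
  pose N := (Num.truncn (t / h0)).+1.
  have N0 : 0 < N%:R :> R by rewrite ltr0n.
  have tN : t / h0 < N%:R by exact: truncnS_gt.
  have h1 : 0 < t / N%:R by rewrite divr_gt0.
  have h2 : t / N%:R < h0 by rewrite ltr_pdivrMr // mulrC -ltr_pdivrMr.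
  have := comm_telescope h1 (small _ h1 h2) Xe N 0 p q.
  rewrite mul0r P0 [N%:R * (t / _)]mulrC divfK ?gt_eqF // => /le_trans; apply.
  have rct : rc t = N%:R * rc (t / N%:R).
    have <- : rc N%:R = N%:R :> C by exact: (rmorph_nat (real_complex R)).
    have <- : rc (N%:R * (t / N%:R)) = rc N%:R * rc (t / N%:R).
      exact: (rmorphM (real_complex R)).
    by rewrite mulrC divfK // gt_eqF.
  rewrite /K rct le_eqVlt; apply/orP; left; apply/eqP; ring.
apply/eqP; apply/negPn/negP => nz; have z0 : 0 < `|comm t X p q| by rewrite normr_gt0.
set z := `|_| in bound z0.
(* Dividing by [K + 1] avoids the case [K = 0]; with [c = z / (K + 1)] the bound would give
   [K + 1 <= K]. *)
have K1 : 0 < K + 1 by rewrite ltr_wpDl.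
have := bound _ (divr_gt0 z0 K1).
rewrite mulrA ler_pdivlMr // mulrC ler_pM2r //.
by rewrite -subr_ge0 opprD addNKr ler0N1.
Qed.

End Commutator.

Lemma semigroup_covariant t : Weyl_covariant L -> 0 <= t -> Weyl_covariant (Phi t).
Proof. by move=> cov t0 X a b; apply/eqP; rewrite -subr_eq0; apply/eqP/comm0. Qed.

End Limits.

Theorem theorem6p4 (R : realType) (n : nat)
    (Phi : R -> {linear 'M[R[i]]_n.+1 -> 'M[R[i]]_n.+1})
    (L : 'M[R[i]]_n.+1 -> 'M[R[i]]_n.+1) :
  unital_QDS Phi L ->
  [<-> (forall t : R, 0 <= t -> mixed_Weyl_unitary (Phi t));
       Weyl_Lindblad L;
       Weyl_covariant L].
Proof.
move=> QDS; have [_ _ ch _ _] := QDS; split; last split.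
(* The three goals form a cycle. Here (i) gives (ii) through covariance of [L], a limit of covariant
   maps. *)
- move=> mixed; pose l := HB.pack_for {linear 'M[R[i]]_n.+1 -> 'M[R[i]]_n.+1} L
    (GRing.isLinear.Build _ _ _ _ L (generator_linear QDS)).
  apply: (@covariant_Lindblad _ _ l).
  + exact: generator_unital QDS.
  + exact: generator_coef_ge0 QDS.
  + by apply: (generator_covariant QDS) => t t0; exact/mixed_covariant/mixed/ltW.
- exact: Lindblad_covariant.
move=> cov t t0; have [cp [_ un]] := ch t t0.
exact/covariant_mixed/(semigroup_covariant QDS).
Qed.
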